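(* Let $S'=K[x_1,\ldots,x_{n-1}]$, $S=S'[x_n]$, $d$ a positive integer, and $I\subset S$ an ideal generated by square free monomials of degrees $\geq d$. Let $x_nf_1,\ldots,x_nf_r$ ($r>0$) be all the square free monomials of degree $d$ in $I\cap(x_n)$ (so $f_i\in S'$ are square free monomials of degree $d-1$). Set $U=(f_1,\ldots,f_r)\subset S'$ and $V=I\cap S'$. If $r>\rho_d(U)-\rho_d(U\cap V)$, then $$\operatorname{depth}_S S/I=\operatorname{depth}_{S'}(U+V)/V=d-1.$$
   Context: $K$ is a field; for a monomial ideal $L$ (in $S$ or $S'$), $\rho_k(L)$ denotes the number of square free monomials of degree $k$ belonging to $L$; depth is taken with respect to the maximal graded ideal of the relevant ring. *)

(* Defs.v *)
From HB Require Import structures.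
From mathcomp Require Import all_boot all_algebra.
From mathcomp Require Import mpoly.
From Stdlib Require Import ClassicalEpsilon.
Set Implicit Arguments.
Unset Strict Implicit.
Unset Printing Implicit Defensive.
Import GRing.Theory.
Local Open Scope ring_scope.

Definition pbool (P : Prop) : bool :=
  if excluded_middle_informative P then true else false.

Section Generic.
Variable R : comRingType.

Definition gen_ideal (gs : seq R) (x : R) : Prop :=
  exists cs : seq R, size cs = size gs /\
    x = \sum_(i < size gs) cs`_i * gs`_i.

Definition ideal_add (A B : R -> Prop) (x : R) : Prop :=
  exists a b, A a /\ B b /\ x = a + b.

Definition ideal_cap (A B : R -> Prop) (x : R) : Prop := A x /\ B x.

Definition seq_times (as_ : seq R) (N : R -> Prop) (x : R) : Prop :=
  exists ys : seq R, size ys = size as_ /\ (forall i, (i < size as_)%N -> N ys`_i) /\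
    x = \sum_(i < size as_) as_`_i * ys`_i.

(* For ideals L <= N of R, consider the R-module M = N/L.
   The submodule (a_1,...,a_k)M corresponds to L + (a_1,...,a_k)N:
   x \in N represents 0 in M/(a)M iff x \in L + (a)N. *)
Definition quot_rel (N L : R -> Prop) (as_ : seq R) : R -> Prop :=
  ideal_add L (seq_times as_ N).

Definition regular_seq (m N L : R -> Prop) (as_ : seq R) : Prop :=
  (forall i, (i < size as_)%N -> m as_`_i) /\
  (forall i, (i < size as_)%N -> forall x, N x ->
      quot_rel N L (take i as_) (as_`_i * x) -> quot_rel N L (take i as_) x) /\
  ~ (forall x, N x -> quot_rel N L as_ x).

Definition depth_eq (m N L : R -> Prop) (k : nat) : Prop :=
  (exists as_ : seq R, size as_ = k /\ regular_seq m N L as_) /\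
  (forall as_ : seq R, regular_seq m N L as_ -> (size as_ <= k)%N).

End Generic.

Definition max_graded (K : fieldType) (n : nat) (p : {mpoly K[n]}) : Prop :=
  p@_(0%MM) = 0.

Definition whole (R : Type) (x : R) : Prop := True.

Definition sqf_mon (K : fieldType) (n : nat) (A : {set 'I_n}) : {mpoly K[n]} :=
  \prod_(i in A) 'X_i.

Definition rho (K : fieldType) (n : nat) (k : nat) (L : {mpoly K[n]} -> Prop) : nat :=
  #|[set B : {set 'I_n} | (#|B| == k) && pbool (L (sqf_mon K B))]|.

(* Main.v *)
Require Import Defs.
From HB Require Import structures.
From mathcomp Require Import all_boot all_algebra.
From mathcomp Require Import mpoly ring zify.
From Stdlib Require Import FunctionalExtensionality PropExtensionality.
From Stdlib Require Import ClassicalEpsilon.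
Set Implicit Arguments.
Unset Strict Implicit.
Unset Printing Implicit Defensive.
Import GRing.Theory.
Local Open Scope ring_scope.

(**
Write [h_i] for the complete homogeneous symmetric polynomials. Splitting off one variable [x], a
quotient of square free monomial ideals is an extension of a module killed by [x] by a module
[M[x]]; on the former [h_i] acts as the [h_i] of the remaining variables, and in the latter [h_i]
is monic in [x], so that dividing by it leaves a free module and turns [h_(i+1)] into the
[h_(i+1)] of the remaining variables. By induction [h_1, ..., h_(d-1)] is regular both on [S/I]
and on [(U+V)/V].

For the upper bound, a Koszul cycle in degree [i] that is not a boundary limits the length of a
regular sequence to the number of variables minus [i]. The condition on [r] says that a
homogeneous linear system, with one unknown for each [f_i] and one equation for each square free
monomial of degree [d] in [U] but not in [V], has a nonzero solution, and this solution gives such a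
cycle with [i] equal to the number of variables minus [d-1], both for [(U+V)/V] and for [S/I].
*)

(** * Extensionality and decidability of propositions *)

Lemma predeq (T : Type) (P Q : T -> Prop) : (forall x, P x <-> Q x) -> P = Q.
Proof.
by move=> h; apply: functional_extensionality => x; apply: propositional_extensionality.
Qed.

Lemma pboolP (P : Prop) : reflect P (pbool P).
Proof. by rewrite /pbool; case: excluded_middle_informative => h; constructor. Qed.

(** * Ideals and weakly regular sequences on a quotient of ideals *)

Section WeakRegularity.
Variable R : comNzRingType.
Implicit Types (N L Q : R -> Prop) (s : seq R).

Definition is_ideal N :=
  [/\ N 0, (forall x y, N x -> N y -> N (x - y)) & (forall a x, N x -> N (a * x))].

Lemma idealN N x : is_ideal N -> N x -> N (- x).
Proof. by case=> h0 hB _ hx; rewrite -sub0r; apply: hB. Qed.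

Lemma idealD N x y : is_ideal N -> N x -> N y -> N (x + y).
Proof.
move=> hN hx hy; rewrite -[y]opprK; case: (hN) => _ hB _; apply: hB => //.
exact: idealN.
Qed.

Lemma idealB N x y : is_ideal N -> N x -> N y -> N (x - y).
Proof. by case=> _ h _; apply: h. Qed.

Lemma idealM N a x : is_ideal N -> N x -> N (a * x).
Proof. by case=> _ _ h; apply: h. Qed.

Lemma ideal_sum N (I : Type) (r : seq I) (P : pred I) (f : I -> R) :
  is_ideal N -> (forall i, P i -> N (f i)) -> N (\sum_(i <- r | P i) f i).
Proof. by move=> hN hf; elim/big_ind: _ => //; [case: hN | move=> x y; apply: idealD]. Qed.

Lemma ideal_addr N x y : is_ideal N -> N y -> N (x + y) <-> N x.
Proof.
move=> hN hy; split=> h; last exact: idealD.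
by rewrite -(addrK y x); apply: idealB.
Qed.

(* The submodule [L + a N]; for [L <= N] the quotient by it is [(N/L)/a(N/L)]. *)
Definition adj N L (a x : R) : Prop := exists2 y, N y & L (x - a * y).

(** Regularity of [s] on N/L without the condition that the last quotient be nonzero. Enlarging [L]
    inside [N] replaces the formation of quotient modules. *)
Fixpoint wreg N L s : Prop :=
  if s is a :: s' then
    (forall x, N x -> L (a * x) -> L x) /\ wreg N (adj N L a) s'
  else True.

Fixpoint adjs N L s : R -> Prop :=
  if s is a :: s' then adjs N (adj N L a) s' else L.

Lemma adj_ideal N L a : is_ideal N -> is_ideal L -> is_ideal (adj N L a).
Proof.
move=> hN hL; split.
- exists 0; first by case: hN.
  by rewrite mulr0 subr0; case: hL.
- move=> x x' [y hy hx] [y' hy' hx']; exists (y - y'); first exact: idealB.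
  have -> : x - x' - a * (y - y') = (x - a * y) - (x' - a * y') by ring.
  exact: idealB.
- move=> b x [y hy hx]; exists (b * y); first exact: idealM.
  have -> : b * x - a * (b * y) = b * (x - a * y) by ring.
  exact: idealM.
Qed.

Lemma adj_sub N L a x : is_ideal N -> L x -> adj N L a x.
Proof. by case=> h0 _ _ hx; exists 0 => //; rewrite mulr0 subr0. Qed.

Lemma adj_mem N L a y : is_ideal L -> N y -> adj N L a (a * y).
Proof. by case=> h0 _ _ hy; exists y => //; rewrite subrr. Qed.

Lemma adjC N L a b : adj N (adj N L a) b = adj N (adj N L b) a.
Proof.
have aux c e x : adj N (adj N L c) e x -> adj N (adj N L e) c x.
  by case=> y hy [y' hy' h]; exists y' => //; exists y => //; rewrite addrAC.
by apply: predeq => x; split; apply: aux.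
Qed.

Lemma adj_congr N L a b : is_ideal L ->
  (forall y, N y -> L ((a - b) * y)) -> adj N L a = adj N L b.
Proof.
move=> hL hab; apply: predeq => x; split=> -[y hy h]; exists y => //.
- have -> : x - b * y = (x - a * y) + (a - b) * y by ring.
  by apply: idealD => //; apply: hab.
- have -> : x - a * y = (x - b * y) - (a - b) * y by ring.
  by apply: idealB => //; apply: hab.
Qed.

End WeakRegularity.

(** The relation [E] stands for the graph of an isomorphism from N1/L1 to N2/L2 under which the two
    members of each pair in [ps] act alike. Its properties survive division by such a pair, also
    when the two rings differ. *)
Lemma wreg_transfer (R1 R2 : comNzRingType) (E : R1 -> R2 -> Prop)
    (N1 L1 : R1 -> Prop) (N2 L2 : R2 -> Prop) (ps : seq (R1 * R2)) :
  (forall x, N1 x -> exists2 y, N2 y & E x y) ->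
  (forall y, N2 y -> exists2 x, N1 x & E x y) ->
  (forall p x y x' y', p \in ps -> N1 x' -> N2 y' -> E x y -> E x' y' ->
     E (p.1 * x') (p.2 * y') /\ E (x - p.1 * x') (y - p.2 * y')) ->
  (forall x y, E x y -> L1 x <-> L2 y) ->
  wreg N1 L1 [seq p.1 | p <- ps] -> wreg N2 L2 [seq p.2 | p <- ps].
Proof.
move=> h12 h21; elim: ps L1 L2 => [//|[a b] ps IH] L1 L2 hE hL /= [h1 h2].
have hab := hE (a, b) _ _ _ _ (mem_head _ _).
split.
  move=> y hy; have [x hx exy] := h21 y hy.
  have [eab _] := hab x y x y hx hy exy exy.
  by move/(hL _ _ eab)/(h1 x hx)/(hL _ _ exy).
apply: IH h2 => [p x y x' y' hp|x y exy].
  by apply: hE; rewrite inE hp orbT.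
split=> -[z hz h].
  have [z' hz' ez] := h12 z hz; exists z' => //.
  by have [_ e] := hab _ _ _ _ hz hz' exy ez; apply/(hL _ _ e).
have [z' hz' ez] := h21 z hz; exists z' => //.
by have [_ e] := hab _ _ _ _ hz' hz exy ez; apply/(hL _ _ e).
Qed.

Lemma wreg_transfer_same (R : comNzRingType) (E : R -> R -> Prop)
    (N1 L1 N2 L2 : R -> Prop) (s : seq R) :
  (forall x, N1 x -> exists2 y, N2 y & E x y) ->
  (forall y, N2 y -> exists2 x, N1 x & E x y) ->
  (forall a x y x' y', N1 x' -> N2 y' -> E x y -> E x' y' ->
     E (a * x') (a * y') /\ E (x - a * x') (y - a * y')) ->
  (forall x y, E x y -> L1 x <-> L2 y) ->
  wreg N1 L1 s -> wreg N2 L2 s.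
Proof.
move=> h12 h21 hE hL w.
have es (f : R * R -> R) : (forall x, f (x, x) = x) -> s = [seq f p | p <- [seq (x, x) | x <- s]].
  by move=> hf; rewrite -map_comp (eq_map (g := id)) ?map_id.
rewrite (es snd) //; rewrite (es fst) // in w.
apply: (wreg_transfer h12 h21 _ hL) w => p x y x' y' /mapP[c _ ->] /=; exact: hE.
Qed.

(** * Weak regularity in extensions of modules *)

Section Extension.
Variable R : comNzRingType.
Implicit Types (N L Q : R -> Prop) (s : seq R).

(** This is the exact sequence from Q/L through N/L to N/Q. It stays exact modulo [a], because [a]
    is regular on N/Q. *)
Lemma wreg_extension N Q L s :
  is_ideal N -> is_ideal Q -> is_ideal L ->
  (forall x, L x -> Q x) -> (forall x, Q x -> N x) ->
  wreg Q L s -> wreg N Q s -> wreg N L s.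
Proof.
elim: s Q L => [//|a s IH] Q L hN hQ hL LQ QN /= [r1 w1] [r2 w2]; split.
  move=> x hx hax; apply: r1 (hax); apply: r2 => //; exact: LQ hax.
have hQ' := adj_ideal a hN hQ; have hL' := adj_ideal a hN hL.
apply: (IH (adj N Q a)) w2 => //.
- by move=> x [y hy h]; exists y => //; apply: LQ.
- move=> x [y hy h]; rewrite -(subrK (a * y) x).
  by apply: idealD => //; [apply: QN | apply: idealM].
(* Regularity of [a] on N/Q puts an element of Q in L + aN only if it is in L + aQ. Hence Q/(L + aQ)
   is isomorphic to (Q + aN)/(L + aN). *)
apply: (@wreg_transfer_same _ (fun x y => Q x /\ adj N L a (x - y)) Q (adj Q L a)) w1.
- move=> x hx; exists x; first exact: adj_sub.
  by rewrite subrr; case: hL'.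
- move=> y [z hz h]; exists (y - a * z) => //; split=> //.
  have -> : y - a * z - y = - (a * z) by ring.
  by apply: idealN => //; apply: adj_mem.
- move=> c x y x' y' _ _ [hx e] [hx' e']; split; split.
  + exact: idealM.
  + by rewrite -mulrBr; apply: idealM.
  + by apply: idealB => //; apply: idealM.
  + have -> : x - c * x' - (y - c * y') = (x - y) - c * (x' - y') by ring.
    by apply: idealB => //; apply: idealM.
move=> x y [hx exy]; split=> [[z hz h]|hy].
  rewrite -[y](subKr x); apply: idealB => //.
  by exists z => //; apply: QN.
have [z hz h] : adj N L a x by rewrite -(subrK y x); apply: idealD.
exists z => //; apply: r2 => //; rewrite -[a * z](subKr x).
by apply: idealB => //; apply: LQ.
Qed.

Lemma wreg_zero N L s : is_ideal N -> (forall x, N x -> L x) -> wreg N L s.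
Proof.
move=> hN; elim: s L => [//|a s IH] L hL /=; split=> [x hx _|]; first exact: hL.
by apply: IH => x hx; apply: adj_sub => //; apply: hL.
Qed.

(* [u_{j+1}] and [v_{j+1}] agree modulo [u_j], which is killed by [N/L]; successively
   dividing by the [u_j] keeps this true. *)
Lemma wreg_shift N L (u v : nat -> R) t j k :
  is_ideal N -> is_ideal L ->
  (forall i, u i.+1 = v i.+1 + t * u i) -> (forall y, N y -> L (u j * y)) ->
  wreg N L [seq v i | i <- iota j.+1 k] -> wreg N L [seq u i | i <- iota j.+1 k].
Proof.
move=> hN hL huv; elim: k j L hL => [//|k IH] j L hL hj /= [r w].
have e y : N y -> L ((u j.+1 - v j.+1) * y).
  by move=> hy; rewrite huv addrC addKr -mulrA; apply: idealM => //; apply: hj.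
split=> [x hx hux|].
  apply: r => //; have -> : v j.+1 * x = u j.+1 * x - (u j.+1 - v j.+1) * x by ring.
  by apply: idealB => //; apply: e.
rewrite -(adj_congr hL e) in w; apply: IH w; first exact: adj_ideal.
by move=> y hy; apply: adj_mem.
Qed.
End Extension.

(** * Polynomials with coefficients in an ideal, and division by monic polynomials *)

Section PolynomialModules.
Variable R : comNzRingType.
Implicit Types (N L : R -> Prop) (p q a : {poly R}).

Definition coefI N (p : {poly R}) : Prop := forall i, N p`_i.

Lemma coefI_ideal N : is_ideal N -> is_ideal (coefI N).
Proof.
move=> hN; split.
- by move=> i; rewrite coef0; case: hN.
- by move=> p q hp hq i; rewrite coefB; apply: idealB.
- move=> p q hq i; rewrite coefM; apply: ideal_sum => // j _.
  exact: idealM.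
Qed.

Lemma coefI_adj N L c : is_ideal N -> is_ideal L ->
  coefI (adj N L c) = adj (coefI N) (coefI L) c%:P.
Proof.
move=> hN hL; apply: predeq => p; split=> [h|[q hq h] i]; last first.
  by exists q`_i => //; rewrite -coefCM -coefB; apply: h.
have h' i : exists y, N y /\ L (p`_i - c * y) by have [y hy ly] := h i; exists y.
pose f i := sval (constructive_indefinite_description _ (h' i)).
have hf i : N (f i) /\ L (p`_i - c * f i).
  exact: svalP (constructive_indefinite_description _ (h' i)).
(* Cutting the chosen witnesses off at [size p] makes them a polynomial; beyond that, zero is a
   witness. *)
exists (\poly_(i < size p) f i) => i.
  by rewrite coef_poly; case: ifP => _; [case: (hf i) | case: hN].
rewrite coefB coefCM coef_poly; case: ifP => hi; first by case: (hf i).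
by rewrite nth_default 1?leqNgt ?hi // mulr0 subrr; case: hL.
Qed.

(** The leading coefficient of [a * q] is that of [q] and sits in degree at least [D], so it can be
    stripped off inductively. Asking only for coefficients from [D] on yields uniqueness of
    remainders modulo [L]. *)
Lemma monic_coefI L a D q : is_ideal L -> a \is monic -> size a = D.+1 ->
  (forall i, (D <= i)%N -> L (a * q)`_i) -> coefI L q.
Proof.
move=> hL ma sa; have [k] := ubnP (size q); elim: k q => // k IH q.
rewrite ltnS => sq h.
have [->|q0] := eqVneq q 0; first by move=> i; rewrite coef0; case: hL.
have [m hm] : exists m, size q = m.+1.
  by exists (size q).-1; rewrite prednK // size_poly_gt0.
have lq : L (lead_coef q).
  have := h (D + m)%N (leq_addr _ _).
  have -> : (D + m)%N = (size (a * q)).-1 by rewrite size_monicM // sa hm addSn addnS.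
  by rewrite -lead_coefE lead_coef_monicM.
have sq' : (size (q - lead_coef q *: 'X^m)%R < k)%N.
  apply: leq_trans sq; rewrite hm ltnS; apply/leq_sizeP => j hj.
  rewrite coefB coefZ coefXn; case: eqVneq => [->|ne].
    by rewrite mulr1 lead_coefE hm subrr.
  by rewrite mulr0 subr0 nth_default // hm ltn_neqAle eq_sym ne.
have hX i : L (lead_coef q *: 'X^m)`_i.
  by rewrite coefZ mulrC; apply: idealM.
have h' := IH _ sq' _.
move=> i; rewrite -(subrK (lead_coef q *: 'X^m) q) coefD.
apply: idealD => //; apply: h' => j hj; rewrite mulrBr coefB.
apply: idealB => //; first exact: h.
exact: (idealM a (coefI_ideal hL) hX).
Qed.

(** Long division by a monic polynomial only forms linear combinations of the coefficients of [p],
    so everything stays in [N]. *)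
Lemma monic_coefI_div N a D p : is_ideal N -> a \is monic -> size a = D.+1 ->
  coefI N p -> exists q r, [/\ coefI N q, coefI N r, (size r <= D)%N & p = r + a * q].
Proof.
move=> hN ma sa; have [k] := ubnP (size p); elim: k p => // k IH p.
rewrite ltnS => sp h.
have [hs|hs] := leqP (size p) D.
  by exists 0, p; split=> //; rewrite ?mulr0 ?addr0 //; case: (coefI_ideal hN).
have [m hm] : exists m, size p = (D + m).+1.
  by exists (size p - D.+1)%N; rewrite -addSn subnKC.
pose t := lead_coef p *: 'X^m.
have ht : coefI N t by move=> i; rewrite coefZ mulrC; apply: idealM => //; apply: h.
have sp' : (size (p - a * t)%R < k)%N.
  apply: leq_trans sp; rewrite hm ltnS; apply/leq_sizeP => j hj.
  rewrite coefB /t -scalerAr coefZ coefMXn ltnNge (leq_trans (leq_addl D m) hj) /=.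
  have [->|ne] := eqVneq j (D + m)%N.
    rewrite addnK lead_coefE hm /=.
    have : lead_coef a = 1 by apply/monicP.
    by rewrite lead_coefE sa /= => ->; rewrite mulr1 subrr.
  have hj' : (D + m < j)%N by rewrite ltn_neqAle eq_sym ne.
  rewrite [p`_j]nth_default ?hm // [a`_ _]nth_default ?mulr0 ?subr0 //.
  by rewrite sa ltn_subRL addnC.
have hp' : coefI N (p - a * t).
  by apply: (idealB (coefI_ideal hN)) => //; apply: (idealM a (coefI_ideal hN)).
have [q [r [hq hr sr e]]] := IH _ sp' hp'; exists (q + t), r; split=> //.
  exact: (idealD (coefI_ideal hN)).
by rewrite mulrDr addrA -e subrK.
Qed.

(** By division with remainder, N[x]/(L[x] + aN[x]) is a sum of [D] copies of N/L, and constants act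
    on each copy separately. *)
Lemma wreg_monic N L a D s : is_ideal N -> is_ideal L -> a \is monic -> size a = D.+1 ->
  wreg N L s ->
  wreg (coefI N) (adj (coefI N) (coefI L) a) [seq c%:P | c <- s].
Proof.
move=> hN hL ma sa; elim: s L hL => [//|c s IH] L hL /= [r w].
have hN' := coefI_ideal hN; have hL' := coefI_ideal hL.
split=> [p hp|]; last first.
  by rewrite adjC -coefI_adj //; apply: IH => //; apply: adj_ideal.
have [q [t [hq ht st ->]]] := monic_coefI_div hN ma sa hp => h.
apply: idealD; [exact: adj_ideal| | exact: adj_mem].
apply: adj_sub => //.
have hct : adj (coefI N) (coefI L) a (c%:P * t).
  have -> : c%:P * t = c%:P * (t + a * q) - a * (c%:P * q) by ring.
  apply: idealB => //; first exact: adj_ideal.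
  by apply: adj_mem => //; apply: (idealM _ hN').
have {hct} [q' hq' hct] := hct.
(* The remainder [t] has no coefficients from degree [D] on, so there those of [a * q'] lie in
   [L]. *)
have lq' : coefI L q'.
  apply: monic_coefI sa _ => // i hi.
  have := hct i; rewrite coefB coefCM [t`_i]nth_default ?(leq_trans st hi) //.
  by rewrite mulr0 sub0r => /(idealN hL); rewrite opprK.
move=> i; apply: r => //.
rewrite -coefCM -(subrK (a * q') (c%:P * t)); move: i.
by apply: (idealD hL') => //; apply: (idealM _ hL').
Qed.

(* [N0 + x N1[x]], the shape of a square free monomial ideal as seen from one variable. *)
Definition coefI2 N0 N1 (p : {poly R}) : Prop := N0 p`_0 /\ forall i, N1 p`_i.+1.

Lemma coefI2_ideal N0 N1 : is_ideal N0 -> is_ideal N1 -> (forall x, N0 x -> N1 x) ->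
  is_ideal (coefI2 N0 N1).
Proof.
move=> h0 h1 h01; split.
- by split=> [|i]; rewrite coef0; [case: h0 | case: h1].
- move=> p q [p0 p1] [q0 q1]; split=> [|i]; rewrite coefB; exact: idealB.
- move=> p q [q0 q1]; split=> [|i]; rewrite coefM.
    by rewrite big_ord1; apply: idealM.
  apply: ideal_sum => // j _; apply: idealM => //.
  by case: (i.+1 - j)%N => [|k] //; apply: h01.
Qed.

End PolynomialModules.

(** * Adjoining one variable to a sequence of complete homogeneous polynomials *)

Section HomogeneousStep.
Variables (R : comNzRingType) (h : nat -> R) (H : nat -> {poly R}).
Hypotheses (H0 : H 0%N = 1) (HS : forall i, H i.+1 = (h i.+1)%:P + 'X * H i).

Lemma size_H i : size (H i) = i.+1.
Proof.
elim: i => [|i IH]; first by rewrite H0 size_poly1.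
by rewrite HS addrC mulrC size_MXaddC -size_poly_eq0 IH.
Qed.

Lemma monic_H i : H i \is monic.
Proof.
elim: i => [|i IH]; first by rewrite H0 monic1.
apply/monicP; rewrite lead_coefE size_H /= HS coefD coefC addrC coefXM /=.
have := monicP IH; rewrite lead_coefE size_H /= => ->.
by rewrite addr0.
Qed.

Lemma coef0_H i : (H i.+1)`_0 = h i.+1.
Proof. by rewrite HS coefD coefC coefXM /= addr0. Qed.

(** [H j] is monic, hence regular on (N/L)[x], and modulo [H j] the next terms reduce to the [h i].
    The sequence thus gains one element at its front. *)
Lemma wreg_coefI_H (N L : R -> Prop) j k :
  is_ideal N -> is_ideal L -> 
  wreg N L [seq h i | i <- iota j.+1 k] ->
  wreg (coefI N) (coefI L) [seq H i | i <- iota j k.+1].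
Proof.
move=> hN hL w /=; have hN' := coefI_ideal hN; have hL' := coefI_ideal hL.
split=> [p _ hp|].
  by apply: monic_coefI (monic_H j) (size_H j) _ => // i _; apply: hp.
apply: (@wreg_shift _ _ _ H (fun i => (h i)%:P) 'X) => //.
- exact: adj_ideal.
- by move=> y hy; apply: adj_mem.
have := wreg_monic hN hL (monic_H j) (size_H j) w.
by rewrite -map_comp.
Qed.

(** The intermediate ideal is L0 + x N1[x]. Below it lies a copy of (N1/L1)[x]; above it lies N0/L0,
    where [x] acts as zero and [H i] as its constant term [h i]. *)
Lemma wreg_coefI2_H (N0 N1 L0 L1 : R -> Prop) j k :
  is_ideal N0 -> is_ideal N1 -> is_ideal L0 -> is_ideal L1 ->
  (forall x, N0 x -> N1 x) -> (forall x, L0 x -> L1 x) ->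
  (forall x, L0 x -> N0 x) -> (forall x, L1 x -> N1 x) ->
  wreg N0 L0 [seq h i | i <- iota j.+1 k.+1] ->
  wreg N1 L1 [seq h i | i <- iota j.+2 k] ->
  wreg (coefI2 N0 N1) (coefI2 L0 L1) [seq H i | i <- iota j.+1 k.+1].
Proof.
move=> hN0 hN1 hL0 hL1 N01 L01 L0N0 L1N1 w0 w1.
have L0N1 x : L0 x -> N1 x by move/L0N0/N01.
have iN := coefI2_ideal hN0 hN1 N01; have iL := coefI2_ideal hL0 hL1 L01.
have iQ := coefI2_ideal hL0 hN1 L0N1.
apply: (@wreg_extension _ _ (coefI2 L0 N1)) => //.
- by move=> x [x0 x1]; split=> // i; apply: L1N1.
- by move=> x [x0 x1]; split=> //; apply: L0N0.
- have := wreg_coefI_H hN1 hL1 w1.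
  (* Multiplication by ['X] is the isomorphism from (N1/L1)[x] onto the submodule. *)
  apply: (@wreg_transfer_same _ (fun q p => coefI2 L0 L1 (p - q * 'X))).
  + move=> q hq; exists (q * 'X).
      by split=> [|i]; rewrite coefMX /=; [case: hL0 | apply: hq].
    by rewrite subrr; case: iL.
  + move=> p [p0 p1]; exists (\poly_(i < size p) p`_i.+1).
      move=> i; rewrite coef_poly; case: ifP => _ //; by case: hN1.
    split=> [|i]; rewrite coefB coefMX /= ?subr0 // coef_poly; case: ifP => hi.
      by rewrite subrr; case: hL1.
    rewrite nth_default ?subr0; first by case: hL1.
    by rewrite leqW // leqNgt hi.
  + move=> c x y x' y' _ _ e e'.
    have -> : c * y' - c * x' * 'X = c * (y' - x' * 'X) by ring.
    have -> : y - c * y' - (x - c * x') * 'X = (y - x * 'X) - c * (y' - x' * 'X) by ring.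
    have i1 := idealM c iL e'; split=> //; exact: idealB.
  + move=> q p e.
    have -> : coefI2 L0 L1 p <-> coefI2 L0 L1 (q * 'X).
      rewrite -{1}(subrK (q * 'X) p) addrC; exact: ideal_addr.
    split=> [hq|[_ hq] i]; last by have := hq i; rewrite coefMX.
    by split=> [|i]; rewrite coefMX /=; [case: hL0 | apply: hq].
- have eH : [seq H i | i <- iota j.+1 k.+1]
      = [seq p.2 | p <- [seq (h i.+1, H i.+1) | i <- iota j k.+1]].
    by rewrite -map_comp -[j.+1]add1n iotaDl -map_comp.
  have eh : [seq h i | i <- iota j.+1 k.+1]
      = [seq p.1 | p <- [seq (h i.+1, H i.+1) | i <- iota j k.+1]].
    by rewrite -map_comp -[j.+1]add1n iotaDl -map_comp.
  rewrite eH; rewrite eh in w0.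
  apply: (@wreg_transfer R {poly R} (fun y p => p`_0 = y /\ coefI N1 p)
            N0 L0 (coefI2 N0 N1) (coefI2 L0 N1) _ _ _ _ _ w0).
  + move=> y hy; have hP : coefI N1 y%:P.
      by move=> i; rewrite coefC; case: ifP => _; [apply: N01 | case: hN1].
    exists y%:P; last by rewrite coefC.
    by split=> [|i]; [rewrite coefC | apply: hP].
  + by move=> p [p0 p1]; exists p`_0 => //; split=> // -[|i] //; apply: N01.
  + move=> _ x y x' y' /mapP[i _ ->] _ _ [<- hy] [<- hy'] /=.
    have hM := idealM (H i.+1) (coefI_ideal hN1) hy'.
    split; split=> //; rewrite ?coefB -?mul_polyC ?coef0M ?coef0_H //.
    exact: (idealB (coefI_ideal hN1)).
  + by move=> y p [<- hp]; split=> [y0|[]] //; split=> // i; apply: hp.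
Qed.

End HomogeneousStep.

(** * Square free monomial ideals as upward closed families of supports *)

Section MonomialIdeals.
Variables (K : fieldType) (n : nat).
Implicit Types (AA BB : {set {set 'I_n}}) (p q : {mpoly K[n]}) (m : 'X_{1..n}).

Definition msup m : {set 'I_n} := [set i | m i != 0%N].

(** For [AA] closed upwards this is the square free monomial ideal whose square free monomials are
    those indexed by [AA]. *)
Definition Sq AA p : Prop := forall m, p@_m != 0 -> msup m \in AA.

Definition upset AA := forall A B : {set 'I_n}, A \in AA -> A \subset B -> B \in AA.

Lemma SqP AA p : Sq AA p <-> (forall m, msup m \notin AA -> p@_m = 0).
Proof.
split=> h m; first by move=> hm; apply/eqP; apply: contraNT hm => /h.
by apply: contraR => /h ->.
Qed.

Lemma msupD m1 m2 : msup (m1 + m2)%MM = msup m1 :|: msup m2.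
Proof. by apply/setP => i; rewrite !inE mnmDE addn_eq0 negb_and. Qed.

Lemma Sq_ideal AA : upset AA -> is_ideal (Sq AA).
Proof.
move=> hA; split.
- by move=> m; rewrite mcoeff0 eqxx.
- move=> p q /SqP hp /SqP hq; apply/SqP => m hm.
  by rewrite mcoeffB hp // hq // subrr.
- move=> p q hq m; rewrite -mcoeff_msupp => /msuppM_le /allpairsP [[m1 m2] /= [_ h2 ->]].
  rewrite mcoeff_msupp in h2; apply: hA (hq _ h2) _.
  by rewrite msupD subsetUr.
Qed.

Lemma Sq_sub AA BB p : AA \subset BB -> Sq AA p -> Sq BB p.
Proof. by move/subsetP => h hp m /hp /h. Qed.

End MonomialIdeals.

(** * Splitting off the last variable *)

Section LastVariable.
Variables (K : fieldType) (n : nat).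
Implicit Types (p : {mpoly K[n.+1]}) (q : {mpoly K[n]}).

Definition wid (B : {set 'I_n}) : {set 'I_n.+1} := [set widen_ord (leqnSn n) i | i in B].

Definition mext (m : 'X_{1..n}) k : 'X_{1..n.+1} :=
  (mnmwiden m + U_(ord_max) *+ k)%MM.

Lemma widen_neq_max (i : 'I_n) : (ord_max == widen_ord (leqnSn n) i) = false.
Proof. by apply/negbTE; rewrite -val_eqE /= neq_ltn ltn_ord orbT. Qed.

Lemma widenP (P : 'I_n.+1 -> Prop) :
  P ord_max -> (forall i : 'I_n, P (widen_ord (leqnSn n) i)) -> forall i, P i.
Proof.
move=> h0 h i; case: (unliftP ord_max i) => [j ->|-> //].
have -> : lift ord_max j = widen_ord (leqnSn n) j; last exact: h.
by apply/val_inj; rewrite /= /bump leqNgt ltn_ord.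
Qed.

Lemma widen_inj : injective (widen_ord (leqnSn n)).
Proof. by move=> i j /(congr1 val) /= /val_inj. Qed.

Lemma mem_wid (B : {set 'I_n}) i : (widen_ord (leqnSn n) i \in wid B) = (i \in B).
Proof. by rewrite mem_imset //; apply: widen_inj. Qed.

Lemma max_notin_wid (B : {set 'I_n}) : (ord_max \in wid B) = false.
Proof. by apply/negbTE/imsetP => -[i _ /eqP]; rewrite widen_neq_max. Qed.

Lemma card_wid (B : {set 'I_n}) : #|wid B| = #|B|.
Proof. by rewrite card_imset //; apply: widen_inj. Qed.

Lemma mext_max m k : mext m k ord_max = k.
Proof. by rewrite mnmDE mnmwiden_ordmax mulmnE mnm1E eqxx mul1n. Qed.

Lemma mext_widen m k i : mext m k (widen_ord (leqnSn n) i) = m i.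
Proof. by rewrite mnmDE mnmwiden_widen mulmnE mnm1E widen_neq_max addn0. Qed.

Lemma mextK (m : 'X_{1..n.+1}) :
  mext [multinom m (widen_ord (leqnSn n) i) | i < n] (m ord_max) = m.
Proof. by apply/mnmP; apply: widenP => [|i]; rewrite ?mext_max ?mext_widen ?mnmE. Qed.

Lemma msup_mext m k :
  msup (mext m k) = if k is 0%N then wid (msup m) else ord_max |: wid (msup m).
Proof.
apply/setP; apply: widenP => [|i].
  by rewrite inE mext_max; case: k => [|k]; rewrite ?inE ?eqxx ?max_notin_wid.
rewrite inE mext_widen; have := mem_wid (msup m) i; rewrite inE.
by case: k => [|k] <- //; rewrite in_setU1 eq_sym widen_neq_max.
Qed.

Lemma mcoeff_muni p i m : ((muni p)`_i)@_m = p@_(mext m i).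
Proof.
rewrite muniE coef_sum raddf_sum /= [in RHS](mpolyE p) raddf_sum /=.
apply: eq_bigr => m' _; rewrite coefZ coefXn mulr_natr mcoeffMn !mcoeffZ !mcoeffX.
rewrite -[LHS]mulr_natr -mulrA -natrM mulnb; congr (_ * (_ : bool)%:R).
apply/andP/eqP => [[/eqP <- /eqP ->]|->]; first exact: esym (mextK m').
rewrite mext_max eqxx; split=> //; apply/eqP/mnmP => j.
by rewrite mnmE mext_widen.
Qed.

Lemma muni_mwiden q : muni (mwiden q) = q%:P.
Proof.
apply/polyP => i; apply/mpolyP => m; rewrite mcoeff_muni coefC; case: eqP => [->|/eqP i0].
  by rewrite /mext mulm0n addm0 mwiden_mnmwiden.
rewrite (mwidenE (leqnn _)) raddf_sum mcoeff0 /= big1 // => m' _.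
rewrite mcoeffZ mcoeffX; case: eqP => [|_]; last by rewrite mulr0.
move/(congr1 (fun m : 'X_{1..n.+1} => m ord_max)).
by rewrite mext_max mnmwiden_ordmax => i0'; rewrite -i0' in i0.
Qed.

Lemma muni_max : muni ('X_ord_max : {mpoly K[n.+1]}) = 'X.
Proof.
apply/polyP => i; apply/mpolyP => m; rewrite mcoeff_muni coefX mcoeffX.
have -> : (U_(ord_max) == mext m i)%MM = (i == 1%N) && (m == 0)%MM.
  apply/eqP/andP => [h|[/eqP -> /eqP ->]]; last by rewrite /mext mnmwiden0 add0m mulm1n.
  split.
    have := congr1 (fun m : 'X_{1..n.+1} => m ord_max) h.
    by rewrite mext_max mnm1E eqxx => <-.
  apply/eqP/mnmP => j; have := congr1 (fun m : 'X_{1..n.+1} => m (widen_ord (leqnSn n) j)) h.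
  by rewrite mext_widen mnm1E widen_neq_max mnm0E => <-.
by case: eqP => _ /=; rewrite ?mcoeff1 ?mcoeff0.
Qed.

Lemma muni_surj (P : {poly {mpoly K[n]}}) : exists p, muni p = P.
Proof.
exists (mmulti P); rewrite /mmulti raddf_sum /= -[RHS]coefK poly_def.
apply: eq_bigr => i _.
by rewrite muniM muni_mwiden rmorphXn /= muni_max mul_polyC.
Qed.

(** For the ideal J of an upward closed [AA], [deletion] describes the contraction of J to the
    smaller ring, and [link] that of the colon ideal of J by the last variable. *)
Definition deletion (AA : {set {set 'I_n.+1}}) : {set {set 'I_n}} := [set B | wid B \in AA].
Definition link (AA : {set {set 'I_n.+1}}) : {set {set 'I_n}} :=
  [set B | ord_max |: wid B \in AA].

(** The support of a monomial depends on the exponent of the last variable only through its being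
    zero, so all positive exponents impose the same condition. *)
Lemma Sq_muni AA p :
  Sq AA p <-> coefI2 (Sq (deletion AA)) (Sq (link AA)) (muni p).
Proof.
split=> [h|[h0 h1] m].
  by split=> [|i] m; rewrite mcoeff_muni => /h; rewrite msup_mext inE.
rewrite -(mextK m); set m' := [multinom _ | i < n]; rewrite -mcoeff_muni msup_mext.
by case: (m ord_max) => [/h0|i /h1]; rewrite inE.
Qed.

Lemma deletion_upset AA : upset AA -> upset (deletion AA).
Proof. by move=> h A B; rewrite !inE => hA AB; apply: h hA _; apply: imsetS. Qed.

Lemma link_upset AA : upset AA -> upset (link AA).
Proof.
move=> h A B; rewrite !inE => hA AB; apply: h hA _.
by apply: setUS; apply: imsetS.
Qed.

Lemma deletion_link AA : upset AA -> deletion AA \subset link AA.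
Proof. by move=> h; apply/subsetP => B; rewrite !inE => /h; apply; apply: subsetUr. Qed.

End LastVariable.

(** * Regularity of the complete homogeneous symmetric polynomials *)

Section LowerBound.
Variable K : fieldType.

(* Complete homogeneous symmetric polynomials, by [h_(i+1)(y, x) = h_(i+1)(y) + x h_i(y, x)]. *)
Fixpoint hsym n : nat -> {mpoly K[n]} :=
  if n is n'.+1 then
    fix g i := if i is i'.+1 then mwiden (hsym n' i'.+1) + 'X_ord_max * g i' else 1
  else fun i => (i == 0%N)%:R.

Lemma hsym_const n i : (hsym n i.+1)@_0%MM = 0.
Proof.
elim: n i => [|n IH] i /=; first by rewrite mcoeff0.
rewrite mcoeffD (_ : 0%MM = mnmwiden (0%MM : 'X_{1..n})); last by rewrite mnmwiden0.
rewrite mwiden_mnmwiden IH mnmwiden0 rmorphM /=.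
by rewrite mcoeffX mnm1_eq0 mul0r addr0.
Qed.

Lemma muni_hsym0 n : muni (hsym n.+1 0) = 1.
Proof. exact: muni1. Qed.

Lemma muni_hsymS n i :
  muni (hsym n.+1 i.+1) = (hsym n i.+1)%:P + 'X * muni (hsym n.+1 i).
Proof. by rewrite [hsym n.+1 i.+1]/= muniD muniM muni_mwiden muni_max. Qed.

Lemma wreg_muni n (AA BB : {set {set 'I_n.+1}}) s :
  wreg (coefI2 (Sq (K := K) (deletion AA)) (Sq (link AA)))
       (coefI2 (Sq (deletion BB)) (Sq (link BB)))
       [seq muni (hsym n.+1 i) | i <- s] ->
  wreg (Sq AA) (Sq BB) [seq hsym n.+1 i | i <- s].
Proof.
pose ps := [seq (muni (hsym n.+1 i), hsym n.+1 i) | i <- s].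
have -> : [seq hsym n.+1 i | i <- s] = [seq p.2 | p <- ps] by rewrite -map_comp.
have -> : [seq muni (hsym n.+1 i) | i <- s] = [seq p.1 | p <- ps] by rewrite -map_comp.
apply: (@wreg_transfer _ _ (fun P p => muni p = P)).
- by move=> P hP; have [p hp] := muni_surj P; exists p => //; apply/Sq_muni; rewrite hp.
- by move=> p hp; exists (muni p) => //; apply/Sq_muni.
- move=> _ P p P' p' /mapP[i _ ->] _ _ <- <- /=.
  by rewrite muniM muniB muniM.
- by move=> P p <-; split=> /Sq_muni.
Qed.

(** Deletion keeps the bound [k] and the link lowers it by one, just as [wreg_coefI2_H] requires.
    The start [j] is arbitrary because the link branch begins one index later. *)
Lemma wreg_large_faces n (AA BB : {set {set 'I_n}}) j k :
  upset AA -> upset BB -> BB \subset AA ->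
  (forall C, C \in AA -> C \notin BB -> k <= #|C|)%N ->
  wreg (Sq (K := K) AA) (Sq BB) [seq hsym n i | i <- iota j.+1 k].
Proof.
elim: n AA BB j k => [|n IH] AA BB j [|k] // uA uB BA hk.
  (* Without variables the only set is empty, so a positive bound makes the quotient zero. *)
  apply: wreg_zero; first exact: Sq_ideal.
  move=> x hx m hm; have hA := hx m hm; apply: contraLR isT => hB.
  have := hk _ hA hB; rewrite (_ : msup m = set0) ?cards0 //.
  by apply/setP => -[].
apply: wreg_muni; apply: (wreg_coefI2_H (@muni_hsym0 n) (@muni_hsymS n)).
all: try (by apply: Sq_ideal; (apply: deletion_upset || apply: link_upset)).
- by move=> x; apply: Sq_sub; apply: deletion_link.
- by move=> x; apply: Sq_sub; apply: deletion_link.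
- by move=> x; apply: Sq_sub; apply/subsetP => C; rewrite !inE => /(subsetP BA).
- by move=> x; apply: Sq_sub; apply/subsetP => C; rewrite !inE => /(subsetP BA).
- apply: IH => [|||C]; rewrite ?inE.
  + exact: deletion_upset.
  + exact: deletion_upset.
  + by apply/subsetP => C; rewrite !inE => /(subsetP BA).
  + by move=> cA cB; rewrite -(card_wid C); apply: hk.
- apply: IH => [|||C]; rewrite ?inE.
  + exact: link_upset.
  + exact: link_upset.
  + by apply/subsetP => C; rewrite !inE => /(subsetP BA).
  + move=> cA cB; have := hk _ cA cB.
    by rewrite cardsU1 max_notin_wid card_wid.
Qed.

(** Here the empty set lies in the larger family, so the sizes of the members of [BB] are bounded
    instead, and the number of variables must be at least [k]. *)
Lemma wreg_large_nonfaces n (BB : {set {set 'I_n}}) j k :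
  (k <= n)%N -> upset BB -> (forall C, C \in BB -> k < #|C|)%N ->
  wreg (Sq (K := K) setT) (Sq BB) [seq hsym n i | i <- iota j.+1 k].
Proof.
have uT m : upset [set: {set 'I_m}] by move=> A B _ _; rewrite inE.
have dT m : deletion [set: {set 'I_m.+1}] = setT by apply/setP => C; rewrite !inE.
have lT m : link [set: {set 'I_m.+1}] = setT by apply/setP => C; rewrite !inE.
elim: n BB j k => [|n IH] BB j [|k] // kn uB hk.
apply: wreg_muni; rewrite dT lT.
have lk : wreg (Sq (K := K) setT) (Sq (link BB)) [seq hsym n i | i <- iota j.+2 k].
  apply: IH => //; first exact: link_upset.
  move=> C; rewrite inE => /hk; by rewrite cardsU1 max_notin_wid card_wid.
(* Deletion loses a variable but keeps the length, so its induction hypothesis needs k < n.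
   Otherwise [BB] is empty, deletion and link coincide, and the link alone suffices. *)
have [kn'|nk] := ltnP k n; last first.
  have e : deletion BB = link BB.
    have -> : BB = set0.
      apply/setP => C; rewrite [RHS]inE; apply/negbTE/negP => /hk.
      by rewrite ltnNge (leq_trans (max_card _)) // card_ord ltnS.
    by apply/setP => C; rewrite !inE.
  have eI N : coefI2 N N = coefI N :> ({poly {mpoly K[n]}} -> Prop).
    by apply: predeq => P; split=> [[h0 h1] [|i] | h] //; split=> // i; apply: h.
  rewrite e !eI; apply: (wreg_coefI_H (@muni_hsym0 n) (@muni_hsymS n)) => //.
  - exact: Sq_ideal.
  - by apply: Sq_ideal; apply: link_upset.
apply: (wreg_coefI2_H (@muni_hsym0 n) (@muni_hsymS n)) => //.
all: try (by apply: Sq_ideal; (apply: deletion_upset || apply: link_upset || idtac)).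
- by move=> x; apply: Sq_sub; apply: deletion_link.
- by move=> x; apply: Sq_sub; apply: subsetT.
- by move=> x; apply: Sq_sub; apply: subsetT.
- apply: IH => //; first exact: deletion_upset.
  by move=> C; rewrite inE => /hk; rewrite card_wid.
Qed.

End LowerBound.

(** * The Koszul complex and the bound on the length of regular sequences *)

Lemma antisym_sum (V : zmodType) n (g : 'I_n -> 'I_n -> V) :
  (forall j k, g j k = - g k j) -> (forall j, g j j = 0) ->
  \sum_j \sum_k g j k = 0.
Proof.
(* In characteristic two antisymmetry does not make the diagonal vanish, hence the separate
   assumption. *)
move=> hg g0.
have -> : \sum_j \sum_k g j k
    = \sum_(j < n) \sum_(k < n | (j < k)%N) g j k + \sum_(j < n) \sum_(k < n | (k < j)%N) g j k.
  rewrite -big_split /=; apply: eq_bigr => j _.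
  rewrite (bigID (fun k : 'I_n => (j < k)%N)) /=; congr (_ + _).
  rewrite (bigD1 j) ?ltnn //= g0 add0r; apply: eq_bigl => k.
  by rewrite -leqNgt ltn_neqAle andbC.
rewrite [X in _ + X](exchange_big_dep predT) //= -big_split big1 //= => j _.
rewrite -big_split big1 //= => k _.
by rewrite [g k j]hg subrr.
Qed.

Section Koszul.
Variables (R : comNzRingType) (n : nat) (x : 'I_n -> R).
Implicit Types (A C : {set 'I_n}) (j k : 'I_n) (z u v : {set 'I_n} -> R) (c : 'I_n -> R).

(** The sign that moves the basis vector e_j to its place among the sorted e_k with k in [A]. *)
Definition ksign j A : R := (-1) ^+ #|[set k in A | (k < j)%N]|.

(* A chain of degree [i] is a function restricted to the sets with [i] elements; [kdiff] is
   the Koszul differential and [kwedge c] the product with the degree one element [c]. *)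
Definition kdiff z A : R := \sum_(j | j \notin A) ksign j A * x j * z (j |: A).
Definition kwedge c z A : R := \sum_(j in A) ksign j (A :\ j) * c j * z (A :\ j).

Lemma ksignU j k C : k \notin C -> ksign j (k |: C) = (-1) ^+ (k < j)%N * ksign j C.
Proof.
move=> kC; rewrite /ksign -exprD; congr (_ ^+ _); case: (boolP (k < j)%N) => kj.
  have -> : [set l in k |: C | (l < j)%N] = k |: [set l in C | (l < j)%N].
    by apply/setP => l; rewrite !inE; case: eqVneq => [->|] //; rewrite kj.
  by rewrite cardsU1 inE (negbTE kC).
rewrite add0n; apply: eq_card => l; rewrite !inE.
by case: eqVneq => [->|] //; rewrite (negbTE kj) !andbF.
Qed.

Lemma ksign_sqr j C : ksign j C * ksign j C = 1.
Proof. by rewrite /ksign -expr2 sqrr_sign. Qed.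

Lemma ksign_swap (j k : 'I_n) : j != k ->
  (-1) ^+ (j < k)%N = - (-1) ^+ (k < j)%N :> R.
Proof.
by rewrite -val_eqE /=; case: ltngtP => //= _ _; rewrite ?expr0 ?expr1 ?opprK.
Qed.

Lemma kdiff_kdiff z A : kdiff (kdiff z) A = 0.
Proof.
pose g j k := if [&& j \notin A, k \notin A & j != k]
  then ksign j A * x j * (ksign k (j |: A) * x k * z (k |: (j |: A))) else 0.
rewrite -[RHS](antisym_sum (g := g)) /kdiff.
- rewrite big_mkcond; apply: eq_bigr => j _; rewrite /g; case: ifP => jA; last first.
    by rewrite big1.
  rewrite mulr_sumr big_mkcond; apply: eq_bigr => k _.
  by rewrite in_setU1 negb_or eq_sym andbC.
- move=> j k; rewrite /g eq_sym; case: (boolP (j \in A)) => jA; case: (boolP (k \in A)) => kA //=;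
    rewrite ?oppr0 //.
  case: ifP => jk; rewrite ?oppr0 // setUCA !ksignU // (ksign_swap jk).
  set a := ksign j A; set b := ksign k A; ring.
- by move=> j; rewrite /g eqxx !andbF.
Qed.

(** Terms that remove and add the same index make up the right hand side. Terms [f j k], which
    remove [k] and add another index [j], occur in both composites with opposite signs. *)
Lemma kwedge_homotopy c z A :
  kdiff (kwedge c z) A + kwedge c (kdiff z) A = (\sum_j c j * x j) * z A.
Proof.
pose f j k := ksign j A * x j * (ksign k (j |: (A :\ k)) * c k * z (j |: (A :\ k))).
have -> : kdiff (kwedge c z) A =
    \sum_(j | j \notin A) c j * x j * z A + \sum_(j | j \notin A) \sum_(k in A) f j k.
  rewrite -big_split; apply: eq_bigr => j jA /=.
  rewrite /kwedge (bigD1 j) ?setU11 //= setU1K // mulrDr; congr (_ + _).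
    have := ksign_sqr j A; set s := ksign j A => h.
    have -> : s * x j * (s * c j * z A) = s * s * (c j * x j * z A) by ring.
    by rewrite h mul1r.
  rewrite mulr_sumr; apply: eq_big => [k|k /andP[]].
    rewrite in_setU1; case: eqVneq => [->|] /=; last by rewrite andbT.
    by rewrite (negbTE jA).
  rewrite in_setU1 => /orP[->//|kA] kj; rewrite /f.
  suff -> : (j |: A) :\ k = j |: (A :\ k) by [].
  by apply/setP => l; rewrite !inE; case: (eqVneq l j) => [->|] /=; rewrite ?andbT // eq_sym kj.
have -> : kwedge c (kdiff z) A =
    \sum_(k in A) c k * x k * z A - \sum_(k in A) \sum_(j | j \notin A) f j k.
  rewrite -sumrN -big_split; apply: eq_bigr => k kA /=.
  have kC : k \notin A :\ k by rewrite !inE eqxx.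
  rewrite /kdiff (bigD1 k) //= setD1K // mulrDr; congr (_ + _).
    have := ksign_sqr k (A :\ k); set s := ksign k _ => h.
    have -> : s * c k * (s * x k * z A) = s * s * (c k * x k * z A) by ring.
    by rewrite h mul1r.
  rewrite -sumrN mulr_sumr; apply: eq_big => [j|j /andP[]].
    by rewrite !inE negb_and negbK; case: eqVneq => [->|] //=; rewrite ?kA // andbT.
  rewrite !inE negb_and negbK => /orP[->//|jA] jk.
  have jC : j \notin A :\ k by rewrite !inE negb_and jA orbT.
  rewrite /f -{4}(setD1K kA) !ksignU // (ksign_swap jk).
  set a := ksign j _; set b := ksign k _; set t := z _.
  case: (k < j)%N; rewrite /= ?expr1 ?expr0; ring.
rewrite [\sum_(k in A) \sum_(j | _) _]exchange_big /= addrACA subrr addr0.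
rewrite [in RHS](bigID (mem A)) /= mulrDl !mulr_suml addrC; congr (_ + _).
Qed.

Lemma kdiff_mem N z A : is_ideal N ->
  (forall B : {set 'I_n}, #|B| = #|A|.+1 -> N (z B)) -> N (kdiff z A).
Proof.
move=> hN h; apply: ideal_sum => // j jA; apply: idealM => //; apply: h.
by rewrite cardsU1 jA.
Qed.

Lemma kwedge_mem N c z A : is_ideal N ->
  (forall B : {set 'I_n}, #|B|.+1 = #|A| -> N (z B)) -> N (kwedge c z A).
Proof.
move=> hN h; apply: ideal_sum => // j jA; apply: idealM => //; apply: h.
by rewrite (cardsD1 j A) jA.
Qed.

Definition kcycle (N L : R -> Prop) i z :=
  (forall A, #|A| = i -> N (z A)) /\ (forall A, #|A|.+1 = i -> L (kdiff z A)).

Definition kboundary (N L : R -> Prop) i z := exists2 u,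
  forall A, #|A| = i.+1 -> N (u A) & forall A, #|A| = i -> L (z A - kdiff u A).

(* If [a = sum_j c_j x_j] then [a z] is the boundary of [c ^ z] up to [c ^ dz], so [c ^ z] is
   a cycle one degree higher modulo [a]. *)
Lemma wreg_kcycle_size N L i z s : is_ideal N -> is_ideal L ->
  (forall a, a \in s -> exists c, a = \sum_j c j * x j) ->
  kcycle N L i z -> ~ kboundary N L i z -> wreg N L s -> (i + size s <= n)%N.
Proof.
move=> hN; elim: s L i z => [|a s IH] L i z hL hs [zN zL] nb /=.
  (* In degrees above [n] there are no sets, so every cycle would be a boundary. *)
  move=> _; rewrite addn0 leqNgt; apply/negP => ni; apply: nb; exists (fun=> 0).
    by move=> A _; case: hN.
  by move=> A hA; move: (max_card A); rewrite hA card_ord leqNgt ni.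
case=> r w; rewrite -addSnnS.
have [c ha] := hs a (mem_head _ _).
have hd A := kwedge_homotopy c z A; rewrite -ha in hd.
apply: (IH (adj N L a) i.+1 (kwedge c z)) => //.
- exact: adj_ideal.
- by move=> b hb; apply: hs; rewrite inE hb orbT.
- split=> A hA.
    by apply: kwedge_mem => // B; rewrite hA => -[] /zN.
  exists (z A); first by apply: zN; case: hA.
  have -> : kdiff (kwedge c z) A - a * z A = - kwedge c (kdiff z) A.
    by rewrite -hd; ring.
  apply: idealN => //; apply: kwedge_mem => // B hB; apply: zL.
  by case: hA => <-.
(* Suppose c ^ z = du + a v modulo [L]. Applying the differential puts a (z - dv) in [L], and
   regularity of [a] makes [z] the boundary of [v]. *)
case=> u uN uL; apply: nb.
have hv A : exists b, N b /\ (#|A| = i.+1 -> L (kwedge c z A - kdiff u A - a * b)).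
  case: (eqVneq #|A| i.+1) => [/uL [b hb lb]|ne]; first by exists b.
  by exists 0; split; [case: hN | move/eqP; rewrite (negbTE ne)].
pose v A := sval (constructive_indefinite_description _ (hv A)).
have vP A : N (v A) /\ (#|A| = i.+1 -> L (kwedge c z A - kdiff u A - a * v A)).
  exact: svalP (constructive_indefinite_description _ (hv A)).
exists v; first by move=> A _; case: (vP A).
move=> A hA; apply: r.
  apply: idealB => //; first exact: zN.
  by apply: kdiff_mem => // B _; case: (vP B).
have -> : a * (z A - kdiff v A)
    = kdiff (fun B => kwedge c z B - kdiff u B - a * v B) A + kwedge c (kdiff z) A.
  have -> : kdiff (fun B => kwedge c z B - kdiff u B - a * v B) A
      = kdiff (kwedge c z) A - kdiff (kdiff u) A - a * kdiff v A.
    rewrite /kdiff mulr_sumr -!sumrB; apply: eq_bigr => j _; ring.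
  by rewrite kdiff_kdiff mulrBr -hd; ring.
apply: idealD => //; [apply: kdiff_mem | apply: kwedge_mem] => // B; rewrite hA => hB.
  by case: (vP B) => _; apply.
exact: zL.
Qed.

End Koszul.

(** * Regular sequences of the statement in terms of weak regularity *)

Section Depth.
Variable R : comNzRingType.
Implicit Types (N L m : R -> Prop) (s : seq R).

Lemma quot_rel_nil N L : is_ideal L -> quot_rel N L [::] = L.
Proof.
move=> hL; apply: predeq => y; split=> [[l [b [hl [[ys [_ [_ ->]]] ->]]]]|h].
  by rewrite big_ord0 addr0.
exists y, 0; split=> //; split; last by rewrite addr0.
by exists [::]; split=> //; split=> //; rewrite big_ord0.
Qed.

Lemma quot_rel_cons N L a s : quot_rel N L (a :: s) = quot_rel N (adj N L a) s.
Proof.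
apply: predeq => y; split=> -[l [b [hl [[ys [sy [ny ->]]] ->]]]].
  case: ys sy ny => [//|z ys] [sy] ny; rewrite big_ord_recl /=.
  exists (l + a * z), (\sum_(i < size s) s`_i * ys`_i); split.
    by exists z; [exact: (ny 0%N) | rewrite addrK].
  split; last by rewrite addrA.
  by exists ys; split=> //; split=> // i hi; apply: (ny i.+1).
case: hl => z hz hl; exists (l - a * z), (a * z + \sum_(i < size s) s`_i * ys`_i).
split=> //; split; last by rewrite addrA subrK.
exists (z :: ys); split; first by rewrite /= sy.
split; first by case=> [|i] //=; apply: ny.
by rewrite big_ord_recl.
Qed.

Lemma quot_rel_adjs N L s : is_ideal N -> is_ideal L -> quot_rel N L s = adjs N L s.
Proof.
move=> hN; elim: s L => [|a s IH] L hL /=; first exact: quot_rel_nil.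
by rewrite quot_rel_cons IH //; apply: adj_ideal.
Qed.

Lemma wregP N L s : is_ideal N -> is_ideal L ->
  wreg N L s <-> (forall i, (i < size s)%N -> forall y, N y ->
      quot_rel N L (take i s) (s`_i * y) -> quot_rel N L (take i s) y).
Proof.
move=> hN; elim: s L => [|a s IH] L hL //=; split.
  case=> r /IH w [|i] hi y hy /=; first by rewrite quot_rel_nil //; apply: r.
  by rewrite quot_rel_cons; apply: w => //; apply: adj_ideal.
move=> h; split=> [y hy|]; first by have := h 0%N isT y hy; rewrite /= quot_rel_nil.
apply/IH => [|i hi y hy]; first exact: adj_ideal.
by have := h i.+1 hi y hy; rewrite /= quot_rel_cons.
Qed.

Lemma regular_seqP m N L s : is_ideal N -> is_ideal L ->
  regular_seq m N L s <->
  [/\ forall i, (i < size s)%N -> m s`_i, wreg N L s & ~ forall y, N y -> adjs N L s y].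
Proof.
move=> hN hL; rewrite /regular_seq (quot_rel_adjs s hN hL).
split=> [[h1 [/(wregP s hN hL) h2 h3]]|[h1 /(wregP s hN hL) h2 h3]] //.
Qed.
End Depth.

(** * Ideals generated by finite sequences *)

Section GeneratedIdeals.
Variable R : comNzRingType.
Implicit Types (gs : seq R) (N : R -> Prop).

Lemma gen_ideal_ideal gs : is_ideal (gen_ideal gs).
Proof.
split.
- exists (nseq (size gs) 0); rewrite size_nseq; split=> //.
  by rewrite big1 // => i _; rewrite nth_nseq ltn_ord mul0r.
- move=> p q [cs [_ ->]] [cs' [_ ->]].
  exists (mkseq (fun i => cs`_i - cs'`_i) (size gs)); rewrite size_mkseq; split=> //.
  by rewrite -sumrB; apply: eq_bigr => i _; rewrite nth_mkseq // mulrBl.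
- move=> a p [cs [_ ->]].
  exists (mkseq (fun i => a * cs`_i) (size gs)); rewrite size_mkseq; split=> //.
  by rewrite mulr_sumr; apply: eq_bigr => i _; rewrite nth_mkseq // mulrA.
Qed.

Lemma gen_ideal_mem gs g : g \in gs -> gen_ideal gs g.
Proof.
move=> hg; have hi : (index g gs < size gs)%N by rewrite index_mem.
exists (mkseq (fun i => (i == index g gs)%:R) (size gs)); rewrite size_mkseq; split=> //.
rewrite (bigD1 (Ordinal hi)) //= nth_mkseq // eqxx mul1r nth_index // big1 ?addr0 //.
move=> i hne; have /negbTE e : (i : nat) != index g gs := hne.
by rewrite nth_mkseq // e mul0r.
Qed.

Lemma gen_ideal_min gs N p : is_ideal N -> (forall g, g \in gs -> N g) ->
  gen_ideal gs p -> N p.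
Proof.
move=> hN h [cs [_ ->]]; apply: ideal_sum => // i _.
by apply: idealM => //; apply: h; apply: mem_nth.
Qed.

End GeneratedIdeals.

(** * Square free monomials, lowest degree coefficients and a depth criterion *)

Section SquareFree.
Variables (K : fieldType) (n : nat).
Implicit Types (A B C : {set 'I_n}) (AA BB : {set {set 'I_n}}) (G : seq {set 'I_n}).
Implicit Types (p q : {mpoly K[n]}) (m : 'X_{1..n}).

Definition sqf_exp A : 'X_{1..n} := [multinom (i \in A : nat) | i < n].

Lemma sqf_monE A : sqf_mon K A = 'X_[sqf_exp A].
Proof.
rewrite /sqf_mon mpolyXE_id big_mkcond; apply: eq_bigr => i _.
by rewrite mnmE; case: (i \in A).
Qed.

Lemma msup_sqf A : msup (sqf_exp A) = A.
Proof. by apply/setP => i; rewrite inE mnmE; case: (i \in A). Qed.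

Lemma sqf_exp_inj : injective sqf_exp.
Proof. by move=> A B h; rewrite -(msup_sqf A) h msup_sqf. Qed.

Lemma mcoeff_sqf A B : (sqf_mon K A)@_(sqf_exp B) = (A == B)%:R.
Proof. by rewrite sqf_monE mcoeffX inj_eq //; apply: sqf_exp_inj. Qed.

Lemma mdeg_sqf A : mdeg (sqf_exp A) = #|A|.
Proof.
rewrite mdegE -sum1_card [RHS]big_mkcond; apply: eq_bigr => i _.
by rewrite mnmE; case: (i \in A).
Qed.

Lemma Sq_sqf AA A : Sq AA (sqf_mon K A) <-> A \in AA.
Proof.
split=> [h|h m]; first by have := h (sqf_exp A); rewrite msup_sqf mcoeff_sqf eqxx oner_eq0; apply.
rewrite sqf_monE mcoeffX; case: (eqVneq (sqf_exp A) m) => [<- _|_].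
  by rewrite msup_sqf.
by rewrite eqxx.
Qed.

Lemma card_msup m : (#|msup m| <= mdeg m)%N.
Proof.
rewrite mdegE -sum1_card big_mkcond; apply: leq_sum => i _.
by rewrite inE; case: (m i).
Qed.

Definition up G : {set {set 'I_n}} :=
  [set B : {set 'I_n} | has (fun A : {set 'I_n} => A \subset B) G].

Lemma up_upset G : upset (up G).
Proof.
move=> A B; rewrite !inE => /hasP[C hC CA] AB; apply/hasP; exists C => //.
exact: subset_trans CA AB.
Qed.

(** Divisibility of a monomial by a square free one depends only on its support. *)
Lemma gen_idealE G : gen_ideal [seq sqf_mon K A | A <- G] = Sq (up G).
Proof.
apply: predeq => p; split.
  apply: gen_ideal_min; first by apply: Sq_ideal; apply: up_upset.
  by move=> _ /mapP[A hA ->]; apply/Sq_sqf; rewrite inE; apply/hasP; exists A.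
move=> hp; rewrite (mpolyE p) big_seq; apply: ideal_sum; first exact: gen_ideal_ideal.
move=> m; rewrite mcoeff_msupp => /hp; rewrite inE => /hasP[A hA AB].
rewrite -mul_mpolyC.
have -> : m = ((m - sqf_exp A) + sqf_exp A)%MM.
  rewrite submK //; apply/mnm_lepP => i; rewrite mnmE; case: (boolP (i \in A)) => // iA.
  by move/subsetP: AB => /(_ i iA); rewrite inE lt0n.
rewrite mpolyXD -sqf_monE mulrA; apply: idealM; first exact: gen_ideal_ideal.
by apply: gen_ideal_mem; apply: map_f.
Qed.

Lemma upsetU AA BB : upset AA -> upset BB -> upset (AA :|: BB).
Proof.
move=> hA hB A B; rewrite !inE => /orP[h|h] AB.
  by rewrite (hA _ _ h AB).
by rewrite (hB _ _ h AB) orbT.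
Qed.

Lemma Sq_add AA BB : upset AA -> upset BB ->
  ideal_add (Sq (K := K) AA) (Sq BB) = Sq (AA :|: BB).
Proof.
move=> hA hB; have iAB := @Sq_ideal K _ _ (upsetU hA hB).
apply: predeq => p; split=> [[a [b [ha [hb ->]]]]|hp].
  by apply: (idealD iAB); [apply: Sq_sub ha | apply: Sq_sub hb]; rewrite ?subsetUl ?subsetUr.
rewrite (mpolyE p) (bigID (fun m => msup m \in AA)) /=.
eexists; eexists; split; last split; last reflexivity.
  apply: ideal_sum => [|m mA]; first exact: Sq_ideal.
  move=> m'; rewrite mcoeffZ mcoeffX; case: (eqVneq m m') => [<-|_]; rewrite ?mulr0 ?eqxx //.
rewrite big_seq_cond; apply: ideal_sum => [|m /andP[hm mA]]; first exact: Sq_ideal.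
move=> m'; rewrite mcoeffZ mcoeffX; case: (eqVneq m m') => [<-|_]; rewrite ?mulr0 ?eqxx //.
by move=> _; rewrite mcoeff_msupp in hm; have := hp _ hm; rewrite inE (negbTE mA).
Qed.

Lemma wholeE : @whole {mpoly K[n]} = Sq setT.
Proof. by apply: predeq => p; split=> // _ m _; rewrite inE. Qed.

(** All monomials of [p] have at least the degree of [m], and a factor without constant term raises
    degrees strictly. *)
Lemma mcoeff_mul_low AA a p m : a@_0%MM = 0 -> Sq AA p ->
  (forall C, C \in AA -> mdeg m <= #|C|)%N -> (a * p)@_m = 0.
Proof.
move=> ha hp h; apply/eqP; apply: contraT; rewrite -mcoeff_msupp.
case/msuppM_le/allpairsP => -[m1 m2] /= [h1 h2 e].
rewrite !mcoeff_msupp in h1 h2.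
have := leq_trans (h _ (hp _ h2)) (card_msup m2).
rewrite e mdegD -[X in (_ <= X)%N]add0n leq_add2r leqn0 mdeg_eq0 => /eqP m10.
by rewrite m10 ha eqxx in h1.
Qed.

Lemma mcoeff_low AA p m : Sq AA p -> (forall C, C \in AA -> mdeg m < #|C|)%N -> p@_m = 0.
Proof.
move=> /SqP hp h; apply: hp; apply/negP => /h.
by rewrite ltnNge card_msup.
Qed.

Lemma max_gradedP (p : {mpoly K[n]}) : max_graded p ->
  exists c : 'I_n -> {mpoly K[n]}, p = \sum_j c j * 'X_j.
Proof.
move=> hp; pose J q := exists c : 'I_n -> {mpoly K[n]}, q = \sum_j c j * 'X_j.
have hJ : is_ideal J.
  split.
  - by exists (fun=> 0); rewrite big1 // => j _; rewrite mul0r.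
  - move=> q q' [c ->] [c' ->]; exists (fun j => c j - c' j).
    by rewrite -sumrB; apply: eq_bigr => j _; rewrite mulrBl.
  - move=> a q [c ->]; exists (fun j => a * c j).
    by rewrite mulr_sumr; apply: eq_bigr => j _; rewrite mulrA.
rewrite (mpolyE p) big_seq; apply: (ideal_sum (N := J)) => // m.
rewrite mcoeff_msupp => hm.
have /existsP[j hj] : [exists j, m j != 0%N].
  apply: contraR hm => /existsPn h; rewrite (_ : m = 0%MM) ?hp //.
  by apply/mnmP => j; have := h j; rewrite negbK mnm0E => /eqP.
rewrite -mul_mpolyC -(submK (m := U_(j)%MM) (m' := m)) ?mpolyXD ?mulrA; last first.
  by rewrite lep1mP.
apply: idealM => //; exists (fun k => (k == j)%:R).
rewrite (bigD1 j) //= eqxx mul1r big1 ?addr0 // => k /negbTE ->.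
by rewrite mul0r.
Qed.

(** A graded form of Nakayama's lemma: dividing by elements without constant term cannot kill a
    lowest degree monomial. *)
Lemma adjs_mcoeff AA (L : {mpoly K[n]} -> Prop) s p m :
  (forall a, a \in s -> a@_0%MM = 0) -> (forall C, C \in AA -> mdeg m <= #|C|)%N ->
  (forall q, L q -> q@_m = 0) -> adjs (Sq AA) L s p -> p@_m = 0.
Proof.
elim: s L => [|a s IH] L hs hA hL /=; first exact: hL.
apply: IH => // [b hb|q [q' hq' /hL]]; first by apply: hs; rewrite inE hb orbT.
rewrite mcoeffB (mcoeff_mul_low _ hq') ?subr0 //.
by apply: hs; rewrite mem_head.
Qed.

Definition hseq t := [seq hsym K n i | i <- iota 1 t].

Lemma hseq_max t a : a \in hseq t -> a@_0%MM = 0.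
Proof. by case/mapP => -[|i]; rewrite mem_iota // => _ ->; apply: hsym_const. Qed.

Definition mvar (j : 'I_n) : {mpoly K[n]} := 'X_j.

(** The sequence [hseq t] attains the depth, its last quotient being nonzero since the monomial of
    [A0] survives. The cycle in degree [n - t] bounds every regular sequence by [t]. *)
Lemma depth_eq_Sq AA BB t A0 (z : {set 'I_n} -> {mpoly K[n]}) : upset AA -> upset BB ->
  (forall C, C \in AA -> #|A0| <= #|C|)%N -> (forall C, C \in BB -> #|A0| < #|C|)%N ->
  A0 \in AA -> (t <= n)%N ->
  wreg (Sq (K := K) AA) (Sq BB) (hseq t) ->
  kcycle mvar (Sq AA) (Sq BB) (n - t) z ->
  ~ kboundary mvar (Sq AA) (Sq BB) (n - t) z ->
  depth_eq (@max_graded K n) (Sq AA) (Sq BB) t.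
Proof.
move=> uA uB hA hB A0A tn w zc znb.
have iA := @Sq_ideal K _ _ uA; have iB := @Sq_ideal K _ _ uB.
split.
  exists (hseq t); split; first by rewrite size_map size_iota.
  apply/regular_seqP => //; split=> //.
    by move=> i hi; apply: (@hseq_max t); apply: mem_nth.
  move=> /(_ (sqf_mon K A0)) h.
  have : (sqf_mon K A0)@_(sqf_exp A0) = 0.
    apply: (adjs_mcoeff (s := hseq t) (AA := AA) (L := Sq BB)).
    - exact: hseq_max.
    - by move=> C /hA; rewrite mdeg_sqf.
    - by move=> q hq; apply: mcoeff_low hq _ => C /hB; rewrite mdeg_sqf.
    - by apply: h; apply/Sq_sqf.
  by rewrite mcoeff_sqf eqxx => /eqP; rewrite oner_eq0.
move=> s /(regular_seqP _ _ iA iB) [hs ws _].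
have hc a : a \in s -> exists c : 'I_n -> {mpoly K[n]}, a = \sum_j c j * mvar j.
  by case/(nthP 0) => i hi <-; apply: max_gradedP; apply: hs.
rewrite -(leq_add2l (n - t)) subnK //.
exact: wreg_kcycle_size iA iB hc zc znb ws.
Qed.

End SquareFree.

(** * Koszul cycles from solutions of a linear system *)

Lemma exists_kernel_fun (K : fieldType) (T : finType) (F E : {set T}) (M : T -> T -> K) :
  (#|E| < #|F|)%N -> exists y : T -> K,
  [/\ exists2 B, B \in F & y B != 0, forall B, B \notin F -> y B = 0 &
      forall D, D \in E -> \sum_(B in F) y B * M B D = 0].
Proof.
move=> EF; pose A := \matrix_(i < #|F|, j < #|E|) M (enum_val i) (enum_val j).
(* The rank is at most [#|E|], less than the number of rows; [y] is a kernel vector extended by zero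
   outside [F]. *)
have : kermx A != 0.
  by rewrite -mxrank_eq0 mxrank_ker -lt0n subn_gt0 (leq_ltn_trans (rank_leq_col A)).
case/rowV0Pn => w /sub_kermxP wA w0.
pose y B := \sum_i (enum_val i == B)%:R * w 0 i.
have yE i : y (enum_val i) = w 0 i.
  rewrite /y (bigD1 i) //= eqxx mul1r big1 ?addr0 // => j /negbTE ji.
  by rewrite (inj_eq enum_val_inj) ji mul0r.
exists y; split.
- have /existsP[i hi] : [exists i, w 0 i != 0].
    apply: contraR w0 => /existsPn h; apply/eqP/rowP => i; rewrite mxE.
    by apply/eqP; have := h i; rewrite negbK.
  by exists (enum_val i); [apply: enum_valP | rewrite yE].
- move=> B hB; rewrite /y big1 // => i _; case: eqP => [e|]; rewrite ?mul0r //.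
  by rewrite -e enum_valP in hB.
- move=> D hD; rewrite big_enum_val /=.
  have := congr1 (fun X : 'rV_ _ => X 0 (enum_rank_in hD D)) wA; rewrite !mxE => wD.
  rewrite -[RHS]wD.
  by apply: eq_bigr => i _; rewrite yE mxE enum_rankK_in.
Qed.

Section SquareFreeCycles.
Variables (K : fieldType) (n : nat).
Implicit Types (A B C D : {set 'I_n}) (AA BB F : {set {set 'I_n}}) (y : {set 'I_n} -> K).

(* Each square free monomial of degree [d] in [U] but not in [V] imposes one linear equation
   on the coefficients; the numerical hypothesis leaves a nonzero solution. *)
Lemma exists_cycle_coef d F BB :
  (#|[set D : {set 'I_n} | [&& #|D| == d, D \in up (enum F) & D \notin BB]]| < #|F|)%N ->
  exists y B0, [/\ B0 \in F, y B0 != 0, forall B, B \notin F -> y B = 0 &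
    forall D, #|D| = d -> D \notin BB ->
      \sum_(j in D) ksign K j (~: D) * y (D :\ j) = 0].
Proof.
pose M B D : K := \sum_(j in D) ksign K j (~: D) * (D :\ j == B)%:R.
case/(exists_kernel_fun M) => y [[B0 B0F yB0] yF hy]; exists y, B0; split=> // D hD DB.
(* If [D] is not in [U], no [D :\ j] is in [F] and the equation is trivial. *)
have [DU|DU] := boolP (D \in up (enum F)); last first.
  rewrite big1 // => j jD; rewrite yF ?mulr0 //; apply: contra DU => h.
  by rewrite inE; apply/hasP; exists (D :\ j); rewrite ?mem_enum ?subD1set.
have := hy D; rewrite inE hD eqxx DU DB => /(_ isT) hD'; rewrite -[RHS]hD'.
transitivity (\sum_(B in F) \sum_(j in D) ksign K j (~: D) * ((D :\ j == B)%:R * y B)).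
  rewrite exchange_big /=; apply: eq_bigr => j jD; rewrite -mulr_sumr; congr (_ * _).
  have [h|h] := boolP (D :\ j \in F).
    rewrite (bigD1 (D :\ j)) //= eqxx mul1r big1 ?addr0 // => B /andP[_].
    by rewrite eq_sym => /negbTE ->; rewrite mul0r.
  rewrite yF // big1 // => B BF; case: eqP => [e|]; rewrite ?mul0r //.
  by rewrite -e (negbTE h) in BF.
by apply: eq_bigr => B _; rewrite /M mulr_sumr; apply: eq_bigr => j _; ring.
Qed.

(** Indexing by complements gives every term the multidegree of the product of all variables, so
    monomials of degree d-1 sit in Koszul degree n-(d-1). *)
Definition sqf_chain y A : {mpoly K[n]} := y (~: A) *: sqf_mon K (~: A).

(** All terms of the differential at [C] are scalar multiples of one monomial, so being a cycle
    becomes a condition on scalars. *)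
Lemma kdiff_sqf_chain y C : kdiff (@mvar K n) (sqf_chain y) C =
  (\sum_(j in ~: C) ksign K j C * y (~: C :\ j)) *: sqf_mon K (~: C).
Proof.
rewrite scaler_suml /kdiff; apply: eq_big => [j|j jC]; first by rewrite inE.
have -> : sqf_mon K (~: C) = 'X_j * sqf_mon K (~: C :\ j).
  by rewrite /sqf_mon (big_setD1 j) // inE.
rewrite /sqf_chain (_ : ~: (j |: C) = ~: C :\ j); last first.
  by apply/setP => l; rewrite !inE negb_or.
have -> : ksign {mpoly K[n]} j C = (ksign K j C)%:MP by rewrite /ksign rmorph_sign.
by rewrite -!mul_mpolyC mpolyCM /mvar; ring.
Qed.

Lemma kcycle_sqf_chain d AA BB y : upset AA -> upset BB -> (0 < d)%N -> (d.-1 <= n)%N ->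
  (forall B, y B != 0 -> B \in AA) ->
  (forall D, #|D| = d -> D \notin BB ->
      \sum_(j in D) ksign K j (~: D) * y (D :\ j) = 0) ->
  kcycle (@mvar K n) (Sq AA) (Sq BB) (n - d.-1) (sqf_chain y).
Proof.
move=> uA uB d0 dn yA hy.
have iA := @Sq_ideal K _ _ uA; have iB := @Sq_ideal K _ _ uB.
split=> A hA.
  rewrite /sqf_chain; have [->|h] := eqVneq (y (~: A)) 0.
    by rewrite scale0r; case: iA.
  by rewrite -mul_mpolyC; apply: (idealM _ iA); apply/Sq_sqf; apply: yA.
rewrite kdiff_sqf_chain; have [h|h] := boolP (~: A \in BB).
  by rewrite -mul_mpolyC; apply: (idealM _ iB); apply/Sq_sqf.
have := hy (~: A); rewrite setCK => -> //; first by rewrite scale0r; case: iB.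
have := cardsC A; rewrite card_ord; lia.
Qed.

Lemma mcoeff_kdiff_low AA u C m :
  (forall A, #|A| = #|C|.+1 -> Sq (K := K) AA (u A)) ->
  (forall B, B \in AA -> mdeg m <= #|B|)%N -> (kdiff (@mvar K n) u C)@_m = 0.
Proof.
move=> hu hA; rewrite /kdiff raddf_sum big1 //= => j jC.
apply: (mcoeff_mul_low _ (hu (j |: C) _)) hA; last by rewrite cardsU1 jC.
by rewrite rmorphM /= mcoeffX mnm1_eq0 mulr0.
Qed.

(** Boundaries have no coefficient in the lowest degree of [Sq AA], and [Sq BB] starts above it; but
    the chain has the coefficient [y B0] there. *)
Lemma not_kboundary_degree AA BB y B0 :
  (forall C, C \in AA -> #|B0| <= #|C|)%N -> (forall C, C \in BB -> #|B0| < #|C|)%N ->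
  y B0 != 0 -> ~ kboundary (@mvar K n) (Sq AA) (Sq BB) (n - #|B0|) (sqf_chain y).
Proof.
move=> hA hB yB0 [u uN uL].
have hC : #|~: B0| = (n - #|B0|)%N by have := cardsC B0; rewrite card_ord; lia.
have := mcoeff_low (m := sqf_exp B0) (uL _ hC); rewrite mdeg_sqf => /(_ hB).
rewrite mcoeffB (mcoeff_kdiff_low (AA := AA)); first last.
- by rewrite mdeg_sqf.
- by move=> A; rewrite hC; apply: uN.
rewrite subr0 /sqf_chain setCK mcoeffZ mcoeff_sqf eqxx mulr1.
by move/eqP; rewrite (negbTE yB0).
Qed.

(* Applying the differential to [z = du + l] gives [dz = dl], whose coefficients of degree [d]
   vanish. *)
Lemma not_kboundary_kdiff N BB y D0 : D0 != set0 ->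
  (forall C, C \in BB -> #|D0| <= #|C|)%N ->
  \sum_(j in D0) ksign K j (~: D0) * y (D0 :\ j) != 0 ->
  ~ kboundary (@mvar K n) N (Sq BB) (n - #|D0|.-1) (sqf_chain y).
Proof.
rewrite -card_gt0 => D00 hB hy [u _ uL]; case/negP: hy; apply/eqP.
have := cardsC D0; rewrite card_ord => hC.
have : (kdiff (@mvar K n) (fun A => sqf_chain y A - kdiff (@mvar K n) u A)
          (~: D0))@_(sqf_exp D0) = 0.
  apply: mcoeff_kdiff_low; last by rewrite mdeg_sqf; exact: hB.
  by move=> A hA; apply: uL; rewrite hA; lia.
have -> : kdiff (@mvar K n) (fun A => sqf_chain y A - kdiff (@mvar K n) u A) (~: D0) =
    kdiff (@mvar K n) (sqf_chain y) (~: D0).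
  rewrite -[RHS]subr0 -[X in _ - X](kdiff_kdiff (@mvar K n) u (~: D0)).
  by rewrite /kdiff -sumrB; apply: eq_bigr => j _; rewrite mulrBr.
by rewrite kdiff_sqf_chain setCK mcoeffZ mcoeff_sqf eqxx mulr1.
Qed.

End SquareFreeCycles.

(** * Carrying the coefficients over to one more variable *)

Section ExtensionByZero.
Variables (K : fieldType) (n : nat).
Implicit Types (B D : {set 'I_n}) (y : {set 'I_n} -> K).

Definition unwid (C : {set 'I_n.+1}) : {set 'I_n} := [set i | widen_ord (leqnSn n) i \in C].

Definition extend0 y (C : {set 'I_n.+1}) : K := if ord_max \in C then 0 else y (unwid C).

Lemma widK B : unwid (wid B) = B.
Proof. by apply/setP => i; rewrite inE mem_wid. Qed.

Lemma unwidK (C : {set 'I_n.+1}) :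
  C = if ord_max \in C then ord_max |: wid (unwid C) else wid (unwid C).
Proof.
apply/setP; apply: widenP => [|i].
  by case: ifP; rewrite ?setU11 // max_notin_wid.
by case: ifP => _; rewrite ?in_setU1 1?eq_sym ?widen_neq_max /= mem_wid inE.
Qed.

(** The last index joins the complement but exceeds every widened one, so it does not affect the
    sign. *)
Lemma ksign_wid j D :
  ksign K (widen_ord (leqnSn n) j) (~: wid D) = ksign K j (~: D).
Proof.
rewrite /ksign -(card_wid [set k in ~: D | (k < j)%N]); congr (_ ^+ _).
apply: eq_card; apply: widenP => [|k].
  by rewrite max_notin_wid !inE /= ltnNge (ltnW (ltn_ord j)) andbF.
by rewrite mem_wid !inE mem_wid.
Qed.

Lemma sum_extend0_wid y D :
  \sum_(j in wid D) ksign K j (~: wid D) * extend0 y (wid D :\ j) =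
  \sum_(j in D) ksign K j (~: D) * y (D :\ j).
Proof.
rewrite big_imset /=; last by move=> i j _ _; apply: widen_inj.
apply: eq_bigr => j _; rewrite ksign_wid /extend0 in_setD1 max_notin_wid andbF.
congr (_ * y _); apply/setP => i; rewrite inE !in_setD1 mem_wid.
by rewrite (inj_eq (@widen_inj n)).
Qed.

(** Removing any other index leaves [ord_max] in the set, where the extension is zero. *)
Lemma sum_extend0_max y B :
  \sum_(j in ord_max |: wid B)
     ksign K j (~: (ord_max |: wid B)) * extend0 y ((ord_max |: wid B) :\ j) =
  ksign K ord_max (~: (ord_max |: wid B)) * y B.
Proof.
rewrite (bigD1 ord_max) ?setU11 //= setU1K ?max_notin_wid // big1 => [|j /andP[_ jm]].
  by rewrite /extend0 max_notin_wid widK addr0.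
by rewrite /extend0 !inE eqxx eq_sym jm mulr0.
Qed.

End ExtensionByZero.

(* S' = K[x_1..x_{n'}] = {mpoly K[n']}, S = S'[x_n] = {mpoly K[n'.+1]}, x_n = 'X_ord_max,
   S' embedded in S by mwiden. *)
Theorem theorem3p3 (K : fieldType) (n' : nat) (d : nat) (G : seq {set 'I_n'.+1}) :
  (0 < d)%N ->
  (forall A, A \in G -> (d <= #|A|)%N) ->
  let I : {mpoly K[n'.+1]} -> Prop := gen_ideal [seq sqf_mon K A | A <- G] in
  (* the f_i : square free monomials of degree d-1 of S' with x_n f_i in I *)
  let F : {set {set 'I_n'}} :=
    [set B : {set 'I_n'} | (#|B| == d.-1) &&
       pbool (I ('X_ord_max * mwiden (sqf_mon K B)))] in
  let r := #|F| in
  let U : {mpoly K[n']} -> Prop := gen_ideal [seq sqf_mon K B | B in F] in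
  let V : {mpoly K[n']} -> Prop := fun g => I (mwiden g) in
  (0 < r)%N ->
  (rho d U - rho d (ideal_cap U V) < r)%N ->
  depth_eq (@max_graded K n'.+1) (@whole _) I d.-1 /\
  depth_eq (@max_graded K n') (ideal_add U V) V d.-1.
Proof.
move=> d0 hG I F r U V r0 hr.
have IE : I = Sq (up G) by exact: gen_idealE.
have uG := @up_upset _ G.
have hup C : C \in up G -> (d <= #|C|)%N.
  by rewrite inE => /hasP[A /hG dA /subset_leq_card]; apply: leq_trans.
set VV := deletion (up G).
have VE : V = Sq VV.
  apply: predeq => g; rewrite /V IE; rewrite Sq_muni muni_mwiden.
  split=> [[]|h]; rewrite /coefI2 coefC //; split=> // i m.
  by rewrite coefC mcoeff0 eqxx.
have uV : upset VV by exact: deletion_upset.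
have hV C : C \in VV -> (d <= #|C|)%N by rewrite inE -(card_wid C); apply: hup.
have UE : U = Sq (up (enum F)) by exact: gen_idealE.
have uF := @up_upset _ (enum F).
have inF B : B \in F -> #|B| = d.-1 /\ ord_max |: wid B \in up G.
  rewrite inE => /andP[/eqP -> /pboolP]; rewrite IE => /Sq_muni [_ /(_ 0%N)].
  rewrite muniM muni_max muni_mwiden coefXM /= coefC => /Sq_sqf.
  by rewrite inE.
(* Since the monomials of the intersection are among those of [U], the truncated difference of the
   two [rho] is a genuine count, namely of the degree d monomials in [U] but not in [V]. *)
have hcard : (#|[set D : {set 'I_n'} | [&& #|D| == d, D \in up (enum F) & D \notin VV]]| < #|F|)%N.
  apply: leq_ltn_trans hr; rewrite /rho.
  set S1 := [set B | _ & pbool (U _)]; set S2 := [set B | _ & pbool (ideal_cap U V _)].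
  have S21 : S2 \subset S1.
    apply/subsetP => B; rewrite !inE => /andP[-> /pboolP[UB _]].
    by apply/pboolP.
  rewrite -(setIidPr S21) -cardsD.
  apply/subset_leq_card/subsetP => D; rewrite inE => /and3P[cD DU DV].
  rewrite in_setD !inE cD /=.
  apply/andP; split; last by apply/pboolP; rewrite UE; apply/Sq_sqf.
  by apply/pboolP => -[_]; rewrite VE => /Sq_sqf; rewrite (negbTE DV).
have [y [B0 [B0F yB0 yF hy]]] := exists_cycle_coef K hcard.
have [cB0 B0max] := inF _ B0F.
have dn : (d.-1 <= n')%N by rewrite -cB0 -[X in (_ <= X)%N]card_ord max_card.
have hU C : C \in up (enum F) :|: VV -> (#|B0| <= #|C|)%N.
  rewrite cB0 in_setU => /orP[|/hV]; last by lia.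
  by rewrite inE => /hasP[B]; rewrite mem_enum => /inF[<- _] /subset_leq_card.
have hV' C : C \in VV -> (#|B0| < #|C|)%N by move/hV; rewrite cB0; lia.
have uUV := upsetU uF uV.
split; last first.
  rewrite UE VE Sq_add //.
  apply: (depth_eq_Sq (A0 := B0) (z := sqf_chain y)) => //.
  - by rewrite in_setU inE; apply/orP; left; apply/hasP; exists B0; rewrite ?mem_enum.
  - apply: wreg_large_faces => // [|C]; first exact: subsetUr.
    by rewrite -cB0 => /hU.
  - apply: kcycle_sqf_chain => // B yB; rewrite inE; apply/orP; left.
    have BF : B \in F by apply: contraR yB => /yF ->.
    by rewrite inE; apply/hasP; exists B; rewrite ?mem_enum.
  - by rewrite -cB0; apply: not_kboundary_degree.
rewrite IE wholeE.
have dn1 : (d.-1 <= n'.+1)%N by exact: leqW.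
have cD0 : #|ord_max |: wid B0| = d by rewrite cardsU1 max_notin_wid card_wid cB0; lia.
(* For S/I the surviving monomial is 1, and the solution [y] is reused on sets avoiding the last
   variable. *)
apply: (depth_eq_Sq (A0 := set0) (z := sqf_chain (extend0 y))) => //.
- by move=> A B _ _; rewrite inE.
- by move=> C _; rewrite cards0.
- by move=> C /hup; rewrite cards0; apply: leq_trans.
- by rewrite inE.
- by apply: wreg_large_nonfaces => // C /hup; lia.
- apply: kcycle_sqf_chain => // [A B _ _|B _|D cD DG]; rewrite ?inE //.
  (* If [D] contains the last variable, the sum has the single term of [B], and [y B] can be nonzero
     only if [D] is in the ideal. Otherwise it is the equation already solved. *)
  move: cD DG; rewrite (unwidK D); case: ifP => _; move: (unwid D) => B cB h.
    rewrite sum_extend0_max yF ?mulr0 //.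
    by apply: contra h => /inF[].
  rewrite sum_extend0_wid; apply: hy; first by rewrite -card_wid.
  by rewrite inE.
(* At x_n times the monomial of [B0], of the least degree d allowed in I, the differential has
   coefficient [y B0] up to sign. *)
- rewrite -cD0; apply: not_kboundary_kdiff.
  + by rewrite -card_gt0 cD0.
  + by move=> C /hup; rewrite cD0.
  + by rewrite sum_extend0_max mulf_neq0 // /ksign signr_eq0.
Qed.
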